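(* Let $\lambda$ be a nonzero real number and let $F_{n,\lambda}(x)$ ($n\ge 0$) be the degenerate Fubini polynomials. Then for every integer $n\ge 1$, $$F_{n,\lambda}(x)=x\sum_{k=0}^{n-1}\binom{n}{k}(1-\lambda)_{n-1-k,\lambda}\,F_{k,\lambda}(x).$$
   Context: For a nonzero real number $\lambda$: generalized falling factorials $(x)_{0,\lambda}=1$, $(x)_{n,\lambda}=x(x-\lambda)\cdots(x-(n-1)\lambda)$ for $n\ge 1$. With $(x)_0=1$ and $(x)_n=x(x-1)\cdots(x-n+1)$ for $n\ge 1$, the degenerate Stirling numbers of the second kind ${n \brace k}_{\lambda}$ ($0\le k\le n$) are defined by the polynomial identity $(x)_{n,\lambda}=\sum_{k=0}^{n}{n \brace k}_{\lambda}(x)_{k}$, $n\ge 0$. The degenerate Fubini polynomials are $F_{n,\lambda}(x)=\sum_{k=0}^{n}{n \brace k}_{\lambda}k!\,x^{k}$. *)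

(* Defs.v *)
From HB Require Import structures.
From mathcomp Require Import all_boot all_order all_algebra.
From mathcomp Require Import reals.

Set Implicit Arguments.
Unset Strict Implicit.
Unset Printing Implicit Defensive.

Import Order.TTheory GRing.Theory Num.Theory.

Local Open Scope ring_scope.

(* (x)_n and (x)_{n,lambda} over an arbitrary commutative ring: they are used *)
(* both on scalars and, with x := 'X, on polynomials.                         *)
Definition falling (A : comNzRingType) (x : A) (n : nat) : A :=
  \prod_(i < n) (x - i%:R).

Definition dfalling (A : comNzRingType) (lambda x : A) (n : nat) : A :=
  \prod_(i < n) (x - i%:R * lambda).

Definition dstirling2_spec (R : comNzRingType) (lambda : R) (n : nat)
    (c : {ffun 'I_n.+1 -> R}) : bool :=
  dfalling lambda%:P 'X n == \sum_(k < n.+1) c k *: falling 'X k.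

Lemma falling_polyE (R : comNzRingType) (n : nat) :
  falling ('X : {poly R}) n = \prod_(i < n) ('X - (i%:R)%:P).
Proof. by apply: eq_bigr => i _; rewrite polyC_natr. Qed.

Lemma size_falling_poly (R : comNzRingType) (n : nat) :
  size (falling ('X : {poly R}) n) = n.+1.
Proof.
by rewrite falling_polyE size_prod_XsubC /index_enum -enumT size_enum_ord.
Qed.

Lemma monic_falling_poly (R : comNzRingType) (n : nat) :
  falling ('X : {poly R}) n \is monic.
Proof. by rewrite falling_polyE monic_prod_XsubC. Qed.

Lemma coef_falling_poly (R : comNzRingType) (n : nat) :
  (falling ('X : {poly R}) n)`_n = 1.
Proof.
by have /monicP := monic_falling_poly R n; rewrite lead_coefE size_falling_poly.
Qed.

Lemma size_dfalling_poly (R : comNzRingType) (lambda : R) (n : nat) :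
  size (dfalling lambda%:P 'X n) = n.+1.
Proof.
have -> : dfalling lambda%:P 'X n = \prod_(i < n) ('X - (i%:R * lambda)%:P).
  by apply: eq_bigr => i _; rewrite polyCM polyC_natr.
by rewrite size_prod_XsubC /index_enum -enumT size_enum_ord.
Qed.

Lemma falling_span (R : comNzRingType) (n : nat) (p : {poly R}) :
  (size p <= n)%N ->
  exists c : nat -> R, p = \sum_(k < n) c k *: falling 'X k.
Proof.
elim: n p => [|n IHn] p.
  by rewrite leqn0 size_poly_eq0 => /eqP ->; exists (fun=> 0); rewrite big_ord0.
move=> sp; have [|c Ec] := IHn (p - p`_n *: falling 'X n).
  apply/leq_sizeP => j; rewrite leq_eqVlt coefB coefZ => /predU1P[<-|ltnj].
    by rewrite coef_falling_poly mulr1 subrr.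
  rewrite nth_default ?(leq_trans sp) // sub0r.
  by rewrite [X in _ * X]nth_default ?mulr0 ?oppr0 // size_falling_poly.
exists (fun k => if k == n then p`_n else c k).
rewrite big_ord_recr /= eqxx -[LHS](subrK (p`_n *: falling 'X n)) Ec.
by congr (_ + _); apply: eq_bigr => k _; rewrite ltn_eqF.
Qed.

Lemma falling_free (R : comNzRingType) (n : nat) (c : nat -> R) :
  \sum_(k < n) c k *: falling 'X k = 0 -> forall k, (k < n)%N -> c k = 0.
Proof.
elim: n => [//|n IHn]; rewrite big_ord_recr /= => E.
have cn0 : c n = 0.
  have /(congr1 (fun p : {poly R} => p`_n)) := E.
  rewrite coefD coefZ coef_falling_poly mulr1 coef0 coef_sum big1 ?add0r //.
  by move=> k _; rewrite coefZ nth_default ?mulr0 // size_falling_poly.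
move: E; rewrite cn0 scale0r addr0 => /IHn c0 k.
by rewrite ltnS leq_eqVlt => /predU1P[->|/c0].
Qed.

Lemma dstirling2_exists (R : comNzRingType) (lambda : R) (n : nat) :
  exists c, dstirling2_spec lambda (n := n) c.
Proof.
have [|c Ec] := @falling_span R n.+1 (dfalling lambda%:P 'X n).
  by rewrite size_dfalling_poly.
exists [ffun k : 'I_n.+1 => c k]; apply/eqP; rewrite Ec.
by apply: eq_bigr => k _; rewrite ffunE.
Qed.

(* The coefficients of (x)_{n,lambda} in the falling factorials (x)_k, k <= n; *)
(* by [dstirling2_unique] they are determined by [dstirling2_spec].            *)
Definition dstirling2 (R : comNzRingType) (lambda : R) (n : nat)
    : {ffun 'I_n.+1 -> R} :=
  xchoose (dstirling2_exists lambda n).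

Lemma dstirling2P (R : comNzRingType) (lambda : R) (n : nat) :
  dfalling lambda%:P 'X n =
  \sum_(k < n.+1) dstirling2 lambda n k *: falling 'X k.
Proof. exact/eqP/(xchooseP (dstirling2_exists lambda n)). Qed.

Lemma dstirling2_unique (R : comNzRingType) (lambda : R) (n : nat)
    (c : {ffun 'I_n.+1 -> R}) :
  dstirling2_spec lambda c -> c = dstirling2 lambda n.
Proof.
move=> /eqP; rewrite dstirling2P => E; apply/ffunP => k; apply/eqP.
rewrite -subr_eq0; apply/eqP.
pose d j := c (inord j) - dstirling2 lambda n (inord j).
suff /(_ k (ltn_ord k)) : forall j, (j < n.+1)%N -> d j = 0.
  by rewrite /d inord_val.
apply: falling_free; rewrite /d.
under eq_bigr => j _ do rewrite inord_val scalerBl.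
by rewrite sumrB -E subrr.
Qed.

Definition dFubini (R : comNzRingType) (lambda : R) (n : nat) : {poly R} :=
  \sum_(k < n.+1) (dstirling2 lambda n k * k`!%:R) *: 'X^k.

(* Main.v *)
Require Import Defs.
From HB Require Import structures.
From mathcomp Require Import all_boot all_order all_algebra.
From mathcomp Require Import reals.
From mathcomp Require Import ring.

Set Implicit Arguments.
Unset Strict Implicit.
Unset Printing Implicit Defensive.

Import Order.TTheory GRing.Theory Num.Theory.

Local Open Scope ring_scope.

(** Expand the forward difference [p(X + 1) - p(X)] of
    [p = (X)_{n,lambda}] in the falling factorials in two ways.

    Since the forward difference of [(X)_{j+1}] is [(j + 1) (X)_j], the
    expansion of [p] itself gives the coefficient
    [(j + 1) S_lambda(n, j + 1)] on [(X)_j], where [S_lambda] denotes the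
    degenerate Stirling numbers.  On the other hand, the degenerate
    Vandermonde identity [dfalling_add] with second argument 1 gives
    [p(X + 1) - p(X) = \sum_(k < n) 'C(n, k) (1)_{n-k,lambda} (X)_{k,lambda}],
    and [(1)_{n-k,lambda} = (1 - lambda)_{n-1-k,lambda}].

    As the falling factorials are linearly independent, the coefficients agree
    ([dstirling2n_rec]); multiplied by [j!], this is the equality of the
    coefficients of degree [j + 1] in the recurrence for the Fubini
    polynomials.  The constant coefficients vanish because
    [(0)_{n,lambda} = 0] for [n >= 1].  The argument works over every
    nontrivial commutative ring and for every [lambda]. *)

Section Factorials.

Variable A : comNzRingType.
Implicit Types lambda x y : A.

Lemma fallingSr x n : falling x n.+1 = falling x n * (x - n%:R).
Proof. by rewrite /falling big_ord_recr. Qed.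

Lemma dfallingSr lambda x n :
  dfalling lambda x n.+1 = dfalling lambda x n * (x - n%:R * lambda).
Proof. by rewrite /dfalling big_ord_recr. Qed.

Lemma dfallingSl lambda x n :
  dfalling lambda x n.+1 = x * dfalling lambda (x - lambda) n.
Proof.
rewrite /dfalling big_ord_recl mul0r subr0; congr (_ * _).
by apply: eq_bigr => i _; rewrite lift0 -natr1; ring.
Qed.

Lemma falling_diff x n :
  falling (x + 1) n.+1 - falling x n.+1 = n.+1%:R * falling x n.
Proof.
have -> : falling (x + 1) n.+1 = (x + 1) * falling x n.
  rewrite /falling big_ord_recl subr0; congr (_ * _).
  by apply: eq_bigr => i _; rewrite lift0 -natr1; ring.
by rewrite fallingSr -natr1; ring.
Qed.

(** The degenerate Vandermonde identity. *)
Lemma dfalling_add lambda x y n :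
  dfalling lambda (x + y) n =
  \sum_(k < n.+1)
     'C(n, k)%:R * (dfalling lambda x k * dfalling lambda y (n - k)).
Proof.
elim: n => [|n IHn].
  by rewrite big_ord1 bin0 subnn /dfalling !big_ord0 !mulr1.
rewrite dfallingSr IHn mulr_suml.
(* Each term splits by x + y - n lambda
   = (x - k lambda) + (y - (n - k) lambda). *)
rewrite (eq_bigr (fun k : 'I_n.+1 =>
  'C(n, k)%:R * (dfalling lambda x k * dfalling lambda y (n.+1 - k)) +
  'C(n, k)%:R * (dfalling lambda x k.+1 * dfalling lambda y (n - k))));
  last first.
  move=> k _; have lekn : (k <= n)%N by rewrite -ltnS.
  by rewrite subSn // !dfallingSr natrB //; ring.
rewrite big_split /= [RHS]big_ord_recl /= bin0.
rewrite [in RHS](eq_bigr (fun k : 'I_n.+1 =>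
  'C(n, k.+1)%:R * (dfalling lambda x k.+1 * dfalling lambda y (n - k)) +
  'C(n, k)%:R * (dfalling lambda x k.+1 * dfalling lambda y (n - k))));
  last first.
  by move=> k _; rewrite -[bump 0 k]/(k.+1) binS natrD mulrDl subSS.
rewrite big_split /= addrA; congr (_ + _).
rewrite big_ord_recl /= bin0; congr (_ + _).
rewrite [RHS]big_ord_recr /= bin_small // mul0r addr0.
by apply: eq_bigr => k _; rewrite -[bump 0 k]/(k.+1) subSS.
Qed.

End Factorials.

Lemma rmorph_falling (A B : comNzRingType) (f : {rmorphism A -> B}) x n :
  f (falling x n) = falling (f x) n.
Proof.
by rewrite rmorph_prod; apply: eq_bigr => i _; rewrite rmorphB rmorph_nat.
Qed.

Lemma rmorph_dfalling (A B : comNzRingType) (f : {rmorphism A -> B}) lambda x n :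
  f (dfalling lambda x n) = dfalling (f lambda) (f x) n.
Proof.
rewrite rmorph_prod; apply: eq_bigr => i _.
by rewrite rmorphB rmorphM rmorph_nat.
Qed.

Section Fubini.

Variables (R : comNzRingType) (lambda : R).

(** The degenerate Stirling numbers as a function of two natural numbers,
    extended by 0 for [k > n]. *)
Definition dstirling2n (n k : nat) : R :=
  if (k <= n)%N then dstirling2 lambda n (inord k) else 0.

Lemma dfalling_dstirling2n n N : (n < N)%N ->
  dfalling lambda%:P 'X n = \sum_(k < N) dstirling2n n k *: falling 'X k.
Proof.
move=> ltnN; pose F k := dstirling2n n k *: falling ('X : {poly R}) k.
transitivity (\sum_(k < n.+1) F k).
  rewrite dstirling2P; apply: eq_bigr => k _.
  by rewrite /F /dstirling2n -ltnS ltn_ord inord_val.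
rewrite (big_ord_widen _ F ltnN) big_mkcond; apply: eq_bigr => k _.
by rewrite /F /dstirling2n ltnS; case: (k <= n)%N; rewrite ?scale0r.
Qed.

Lemma coef_dFubini n k : (dFubini lambda n)`_k = dstirling2n n k * k`!%:R.
Proof.
rewrite /dFubini (eq_bigr (fun i : 'I_n.+1 => (dstirling2n n i * i`!%:R) *: 'X^i)).
  rewrite -(poly_def n.+1 (fun i => dstirling2n n i * i`!%:R)) coef_poly ltnS.
  by case: ifP => // nk; rewrite /dstirling2n nk mul0r.
by move=> i _; rewrite /dstirling2n -ltnS ltn_ord inord_val.
Qed.

Lemma dstirling2n_0 n : dstirling2n n.+1 0 = 0.
Proof.
have horner0_falling k : (falling 'X k : {poly R}).[0] = falling 0 k.
  by rewrite -[LHS]/(horner_eval 0 _) rmorph_falling /= /horner_eval hornerX.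
have /(congr1 (horner_eval 0)) := dfalling_dstirling2n (ltnSn n.+1).
rewrite rmorph_dfalling /= /horner_eval hornerX dfallingSl mul0r.
rewrite horner_sum big_ord_recl big1 => [|k _].
  by rewrite addr0 hornerZ horner0_falling /falling big_ord0 mulr1.
rewrite hornerZ horner0_falling lift0 /falling big_ord_recl subrr mul0r.
exact: mulr0.
Qed.

Lemma dfalling_diff n :
  dfalling lambda%:P ('X + 1) n - dfalling lambda%:P 'X n =
  \sum_(k < n) ('C(n, k)%:R * dfalling lambda (1 - lambda) (n - 1 - k)%N)
                 *: dfalling lambda%:P 'X k.
Proof.
rewrite dfalling_add big_ord_recr /= subnn binn [dfalling _ 1 0]big_ord0.
rewrite mulr1 mul1r addrK; apply: eq_bigr => k _.
have -> : (n - k = (n - 1 - k).+1)%N.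
  by rewrite subnAC subn1 prednK // subn_gt0.
rewrite dfallingSl mul1r -[1 : {poly R}]/(1%:P) -polyCB -rmorph_dfalling.
by rewrite -mul_polyC polyCM polyC_natr; ring.
Qed.

Lemma dstirling2n_rec n j : (j < n)%N ->
  dstirling2n n j.+1 * j.+1%:R =
  \sum_(k < n) ('C(n, k)%:R * dfalling lambda (1 - lambda) (n - 1 - k)%N)
                 * dstirling2n k j.
Proof.
move=> ltjn; apply/eqP; rewrite -subr_eq0; apply/eqP; move: j ltjn.
apply: falling_free; under eq_bigr do rewrite scalerBl.
apply/eqP; rewrite sumrB subr_eq0; apply/eqP.
transitivity (dfalling lambda%:P ('X + 1) n - dfalling lambda%:P 'X n).
  have shift_dfalling :
      dfalling lambda%:P ('X + 1) n = dfalling lambda%:P 'X n \Po ('X + 1).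
    by rewrite (rmorph_dfalling (comp_poly _)) /= comp_polyC comp_polyX.
  rewrite shift_dfalling (dfalling_dstirling2n (ltnSn n)) raddf_sum -sumrB /=.
  rewrite big_ord_recl /= /falling !big_ord0 linearZ /= rmorph1 subrr add0r.
  apply: eq_bigr => k _; rewrite linearZ /= -scalerBr -[bump 0 k]/(k.+1).
  rewrite (rmorph_falling (comp_poly _)) /= comp_polyX falling_diff.
  by rewrite mulr_natl -scaler_nat scalerA.
rewrite dfalling_diff.
under [RHS]eq_bigr do rewrite scaler_suml.
rewrite exchange_big /=; apply: eq_bigr => k _.
rewrite (dfalling_dstirling2n (ltn_ord k)) scaler_sumr.
by apply: eq_bigr => j _; rewrite scalerA.
Qed.

Lemma dFubini_rec n : (0 < n)%N ->
  dFubini lambda n =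
  'X * \sum_(k < n) ('C(n, k)%:R * dfalling lambda (1 - lambda) (n - 1 - k)%N)
                      *: dFubini lambda k.
Proof.
move=> n_gt0; apply/polyP => -[|j]; rewrite coefXM coef_dFubini /=.
  by case: n n_gt0 => // n _; rewrite dstirling2n_0 mul0r.
rewrite coef_sum; under eq_bigr do rewrite coefZ coef_dFubini mulrA.
rewrite -mulr_suml factS natrM mulrA; congr (_ * _).
have [ltjn|lenj] := ltnP j n; first exact: dstirling2n_rec.
(* Beyond degree n, both sides involve only Stirling numbers out of range. *)
rewrite {1}/dstirling2n leqNgt ltnS lenj mul0r big1 // => k _.
by rewrite /dstirling2n leqNgt (leq_trans (ltn_ord k) lenj) mulr0.
Qed.

End Fubini.

Theorem theorem2p12 (R : realType) (lambda : R) (lambda_neq0 : lambda != 0)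
    (n : nat) (n_ge1 : (1 <= n)%N) :
  dFubini lambda n =
  'X * \sum_(k < n) ('C(n, k)%:R * dfalling lambda (1 - lambda) (n - 1 - k)%N)
                      *: dFubini lambda k.
Proof. exact: dFubini_rec. Qed.
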